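(* Let $R$ be a two-branches algebroid curve, let $S\subseteq\mathbb{N}^2$ be its semigroup of values and $\Gamma_R\subseteq\overline{\mathbb{N}}^2$ its semiring of values. Then $\Gamma_S=\Gamma_R$.
   Context: $\mathbb{N}=\{0,1,2,\dots\}$ and $\overline{\mathbb{N}}=\mathbb{N}\cup\{\infty\}$. A two-branches algebroid curve is a one-dimensional ring $R=\mathbb{K}[\![x_1,\dots,x_n]\!]/Q$, $\mathbb{K}$ a field, where $Q=P_1\cap P_2$ with $P_1\neq P_2$ the two minimal primes over $Q$; with $R_i=\mathbb{K}[\![x_1,\dots,x_n]\!]/P_i$ one has $R\hookrightarrow R_1\times R_2$, and the integral closure of $R$ is $\overline{R}\cong\overline{R_1}\times\overline{R_2}\cong\mathbb{K}[\![t_1]\!]\times\mathbb{K}[\![t_2]\!]$. Each $r\in R$ is thus written $r=(r_1,r_2)\in\mathbb{K}[\![t_1]\!]\times\mathbb{K}[\![t_2]\!]$; put $v_i(r)$ equal to the $t_i$-adic order of $r_i$ if $r_i\ne0$ and $v_i(r)=\infty$ if $r_i=0$, and $v(r)=(v_1(r),v_2(r))$. The semiring of values of $R$ is $\Gamma_R=\{v(r): r\in R\}\subseteq\overline{\mathbb{N}}^2$, and the semigroup of values of $R$ is $S=\{v(r): r\in R \text{ is not a zerodivisor}\}\subseteq\mathbb{N}^2$. For the semigroup $S\subseteq \mathbb{N}^2$, put $S_1^\infty=\{(a,\infty): a\in\mathbb{N},\ \exists\,\tilde y\in\mathbb{N}\ \forall y\ge\tilde y,\ (a,y)\in S\}$,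 $S_2^\infty=\{(\infty,b): b\in\mathbb{N},\ \exists\,\tilde x\in\mathbb{N}\ \forall x\ge\tilde x,\ (x,b)\in S\}$, $S^\infty=S_1^\infty\cup S_2^\infty\cup\{(\infty,\infty)\}$ and $\Gamma_S=S\cup S^\infty$. *)

(* Defs.v *)
From HB Require Import structures.
From mathcomp Require Import all_boot all_algebra.
From mathcomp Require Import boolp classical_sets mpoly.

Set Implicit Arguments.
Unset Strict Implicit.
Unset Printing Implicit Defensive.

Import GRing.Theory.
Local Open Scope ring_scope.
Local Open Scope quotient_scope.

(* K[[x_1, ..., x_n]], as families of coefficients indexed by monomials. *)
Record fps (K : Type) (n : nat) := Fps { fcoef : 'X_{1..n} -> K }.

Section PowerSeriesRing.
Variables (K : comNzRingType) (n : nat).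
Local Notation S := (fps K n).
Implicit Types (f g h : S) (m : 'X_{1..n}).

HB.instance Definition _ := gen_eqMixin S.
HB.instance Definition _ := gen_choiceMixin S.

Lemma fpsP f g : fcoef f =1 fcoef g -> f = g.
Proof. by case: f g => [f] [g] /= /funext ->. Qed.

Definition fps_add f g : S := Fps (fun m => fcoef f m + fcoef g m).
Definition fps_opp f : S := Fps (fun m => - fcoef f m).
Definition fpsC (c : K) : S := Fps (fun m => if m == 0%MM then c else 0).

(* The coefficient of x^m is the sum of f_k1 * g_k2 over all m = k1 + k2; the
   degree bound only serves to make the index type finite. *)
Definition fps_mul f g : S :=
  Fps (fun m =>
    \sum_(k : 'X_{1..n < (mdeg m).+1, (mdeg m).+1} | m == (k.1 + k.2)%MM)
      fcoef f k.1 * fcoef g k.2).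

Fact fps_addA : associative fps_add.
Proof. by move=> f g h; apply: fpsP => m /=; rewrite addrA. Qed.
Fact fps_addC : commutative fps_add.
Proof. by move=> f g; apply: fpsP => m /=; rewrite addrC. Qed.
Fact fps_add0 : left_id (fpsC 0) fps_add.
Proof. by move=> f; apply: fpsP => m /=; rewrite if_same add0r. Qed.
Fact fps_addN : left_inverse (fpsC 0) fps_opp fps_add.
Proof. by move=> f; apply: fpsP => m /=; rewrite if_same addNr. Qed.

HB.instance Definition _ :=
  GRing.isZmodule.Build S fps_addA fps_addC fps_add0 fps_addN.

Definition fps_trunc (d : nat) f : {mpoly K[n]} :=
  \sum_(m : 'X_{1..n < d}) fcoef f m *: 'X_[m].

Lemma mcoeff_trunc d f m : (mdeg m < d)%N -> (fps_trunc d f)@_m = fcoef f m.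
Proof.
move=> ltmd; rewrite /fps_trunc raddf_sum /=.
rewrite (bigD1 (BMultinom ltmd)) //= mcoeffZ mcoeffX eqxx mulr1.
rewrite big1 ?addr0 // => k; rewrite bmeqP /= => /negPf nkm.
by rewrite mcoeffZ mcoeffX nkm mulr0.
Qed.

Lemma fps_mul_trunc d f g m : (mdeg m < d)%N ->
  fcoef (fps_mul f g) m = (fps_trunc d f * fps_trunc d g)@_m.
Proof.
move=> ltmd; rewrite mcoeffM; apply: eq_bigr => -[k1 k2] /= /eqP Em.
by rewrite !mcoeff_trunc //; apply: leq_trans ltmd; apply: bmdeg.
Qed.

Fact fps_mulA : associative fps_mul.
Proof.
move=> f g h; apply: fpsP => m; pose d := (mdeg m).+1.
transitivity ((fps_trunc d f * fps_trunc d g * fps_trunc d h)@_m).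
  rewrite -mulrA mcoeffM; apply: eq_bigr => k _.
  by rewrite (@fps_mul_trunc d) ?mcoeff_trunc // bmdeg.
rewrite mcoeffM; apply: esym; apply: eq_bigr => k _.
by rewrite (@fps_mul_trunc d) ?[(fps_trunc d h)@__]mcoeff_trunc // bmdeg.
Qed.

Fact fps_mulC : commutative fps_mul.
Proof.
by move=> f g; apply: fpsP => m; rewrite !(@fps_mul_trunc (mdeg m).+1) // mulrC.
Qed.

Fact fps_mul1 : left_id (fpsC 1) fps_mul.
Proof.
move=> f; apply: fpsP => m; rewrite (@fps_mul_trunc (mdeg m).+1) //.
suff -> : fps_trunc (mdeg m).+1 (fpsC 1) = 1 by rewrite mul1r mcoeff_trunc.
rewrite /fps_trunc; have lt0 : (mdeg (0%MM : 'X_{1..n}) < (mdeg m).+1)%N.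
  by rewrite mdeg0.
rewrite (bigD1 (BMultinom lt0)) //= eqxx scale1r mpolyX0.
rewrite big1 ?addr0 // => k; rewrite bmeqP /= => /negPf ->.
by rewrite scale0r.
Qed.

Fact fps_mulDl : left_distributive fps_mul fps_add.
Proof.
move=> f g h; apply: fpsP => m /=.
by rewrite -big_split /=; apply: eq_bigr => k _; rewrite mulrDl.
Qed.

Fact fps_oner_neq0 : fpsC 1 != fpsC 0.
Proof.
apply/eqP => /(congr1 (fun f => fcoef f 0%MM)) /=; rewrite eqxx.
exact/eqP/oner_neq0.
Qed.

HB.instance Definition _ := GRing.Zmodule_isComNzRing.Build S
  fps_mulA fps_mulC fps_mul1 fps_mulDl fps_oner_neq0.

End PowerSeriesRing.

(* K[[t]]. *)
Notation fps1 K := (fps K 1).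

(* The extended naturals: None is infinity. *)
Notation enat := (option nat).

Definition tcoef (K : Type) (f : fps1 K) (k : nat) : K :=
  fcoef f [multinom k | i < 1].

Definition tord (K : comNzRingType) (f : fps1 K) : enat :=
  match pselect (exists k, tcoef f k != 0) with
  | left nz => Some (ex_minn nz)
  | right _ => None
  end.

Definition zero_divisor (A : comNzRingType) (a : A) : Prop :=
  exists2 b, b != 0 & a * b = 0.

Definition total_fraction_ring (A T : comNzRingType) (i : {rmorphism A -> T}) :=
  [/\ injective i,
      forall a, ~ zero_divisor a -> exists u, i a * u = 1
    & forall z, exists a b, ~ zero_divisor b /\ z * i b = i a].

(* g identifies B with the integral closure of A in its total ring of
   fractions T. *)
Definition is_integral_closure (A B : comNzRingType) (g : {rmorphism A -> B}) :=
  exists (T : comNzRingType) (i : {rmorphism A -> T}) (j : {rmorphism B -> T}),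
    [/\ total_fraction_ring i,
        forall a, j (g a) = i a,
        injective j
      & forall z, integralOver i z <-> exists b, z = j b].

(* Ideals are boolean predicates; as every proposition has a boolean truth
   value in the classical setting, this ranges over all (proper) ideals. *)
Definition minimal_prime_over (A : nzRingType) (Q : {pred A})
    (P : prime_idealr A) :=
  {subset Q <= P} /\
  forall P' : prime_idealr A,
    {subset Q <= P'} -> {subset P' <= P} -> {subset P <= P'}.

Definition prime_chain (A : nzRingType) (d : nat) :=
  exists p : 'I_d.+1 -> prime_idealr A, forall i j : 'I_d.+1, (i < j)%N ->
    {subset p i <= p j} /\ ~ {subset p j <= p i}.

Definition krull_dim_eq (A : nzRingType) (d : nat) :=
  prime_chain A d /\ forall d', prime_chain A d' -> (d' <= d)%N.

(* R = K[[x_1, ..., x_n]] / Q together with an isomorphism of K-algebras from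
   its integral closure to K[[t_1]] x K[[t_2]], given through the induced map
   r |-> (r_1, r_2) on R.  The kernel conditions say that r_i only depends on
   the image of r in R_i = K[[x]] / P_i and embeds R_i in K[[t_i]], i.e. that
   the isomorphism is compatible with R -> R_1 x R_2. *)
Record two_branch_curve (K : fieldType) (n : nat) := TwoBranchCurve {
  curve_ideal : idealr (fps K n);
  branch1 : prime_idealr (fps K n);
  branch2 : prime_idealr (fps K n);
  curve_idealE : forall f,
    (f \in curve_ideal) = (f \in branch1) && (f \in branch2);
  branch_neq : ~ (branch1 =i branch2);
  branch_minimal : forall P : prime_idealr (fps K n),
    minimal_prime_over curve_ideal P <-> (P =i branch1 \/ P =i branch2);
  curve_dim1 : krull_dim_eq {ideal_quot curve_ideal} 1;
  param : {rmorphism {ideal_quot curve_ideal} -> (fps1 K * fps1 K)%type};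
  param_const : forall c : K,
    param (\pi_{ideal_quot curve_ideal} (fpsC n c)) = (fpsC 1 c, fpsC 1 c);
  param_ker1 : forall f,
    (param (\pi_{ideal_quot curve_ideal} f)).1 = 0 <-> f \in branch1;
  param_ker2 : forall f,
    (param (\pi_{ideal_quot curve_ideal} f)).2 = 0 <-> f \in branch2;
  param_integral_closure : is_integral_closure param
}.

Definition curve_ring (K : fieldType) (n : nat) (C : two_branch_curve K n) :
  comNzRingType := {ideal_quot (curve_ideal C)}.

Local Open Scope classical_set_scope.

Section Values.
Variables (K : fieldType) (n : nat) (C : two_branch_curve K n).

Definition value (r : curve_ring C) : enat * enat :=
  (tord (param C r).1, tord (param C r).2).

Definition value_semiring : set (enat * enat) := range value.

Definition value_semigroup : set (nat * nat) :=
  [set ab | exists2 r : curve_ring C,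
      ~ zero_divisor r & value r = (Some ab.1, Some ab.2)].

End Values.

Section Completion.
Variable S : set (nat * nat).

Definition S1_infty : set (enat * enat) :=
  [set (Some a, None) | a in
    [set a | exists y0, forall y, (y0 <= y)%N -> S (a, y)]].

Definition S2_infty : set (enat * enat) :=
  [set (None, Some b) | b in
    [set b | exists x0, forall x, (x0 <= x)%N -> S (x, b)]].

Definition S_infty : set (enat * enat) :=
  S1_infty `|` S2_infty `|` [set (None, None)].

Definition Gamma : set (enat * enat) :=
  [set (Some ab.1, Some ab.2) | ab in S] `|` S_infty.

End Completion.

(* Main.v *)
(** The point is that the image of R in K[[t_1]] x K[[t_2]] contains
    0 x t_2^N K[[t_2]] and t_1^N K[[t_1]] x 0 for some N: adding such elements
    to, or subtracting them from, elements of R passes between the values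
    (a, oo) and the values (a, y) with y large.

    As 1 - c f is invertible for every c in K and every f in the maximal ideal
    of K[[x]], each branch phi : K[[x]] -> K[[t]] is automatically local, hence
    continuous.  Since (t, t) and (0, 1) are fractions of elements of R, there
    are a, b and a0 in K[[x]] with phi(a) = phi(b) t, phi(b) and phi(a0)
    nonzero and a0 vanishing on the other branch.  Products of a0 with
    monomials in a and b realise all large orders of vanishing, in such a way
    that successive approximation converges in K[[x]]: every h of large order
    is phi(a0 g) for some g. *)

Require Import Defs.
From mathcomp Require Import all_boot all_algebra.
From mathcomp Require Import boolp classical_sets mpoly zify ring.

Set Implicit Arguments.
Unset Strict Implicit.
Unset Printing Implicit Defensive.

Import GRing.Theory.
Local Open Scope ring_scope.

(** * The topology of a power series ring: order filtration and completeness *)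

Section PowerSeries.
Variables (K : comNzRingType) (n : nat).
Implicit Types (f g : fps K n) (m u : 'X_{1..n}) (d e : nat).

Lemma fcoefB f g m : fcoef (f - g) m = fcoef f m - fcoef g m.
Proof. by []. Qed.

Lemma fcoefM f g m : fcoef (f * g) m =
  \sum_(k : 'X_{1..n < (mdeg m).+1, (mdeg m).+1} | m == (k.1 + k.2)%MM)
      fcoef f k.1 * fcoef g k.2.
Proof. by []. Qed.

Lemma fcoef_sum (I : finType) (F : I -> fps K n) m :
  fcoef (\sum_i F i) m = \sum_i fcoef (F i) m.
Proof.
by apply: (big_morph (fun h : fps K n => fcoef h m)) => //=; rewrite if_same.
Qed.

Definition fps_monomial (c : K) u : fps K n :=
  Fps (fun m => if m == u then c else 0).

Lemma fcoef_monomialM c u f m :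
  fcoef (fps_monomial c u * f) m =
    if (u <= m)%MM then c * fcoef f (m - u)%MM else 0.
Proof.
rewrite fcoefM /=; case: ifP => [le_um|nle_um]; last first.
  rewrite big1 // => -[k1 k2] /= /eqP Em; case: ifP => [/eqP Ek|_]; last first.
    by rewrite mul0r.
  by case/negP: (negbT nle_um); rewrite -Ek [X in (_ <= X)%MM]Em lem_addr.
have Em : m = (u + (m - u))%MM by rewrite addmC submK.
have ltu : (mdeg u < (mdeg m).+1)%N.
  by rewrite ltnS [X in (_ <= mdeg X)%N]Em mdegD leq_addr.
have ltv : (mdeg (m - u)%MM < (mdeg m).+1)%N.
  by rewrite ltnS [X in (_ <= mdeg X)%N]Em mdegD leq_addl.
rewrite (bigD1 (BMultinom ltu, BMultinom ltv)) /=; last by rewrite -Em.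
rewrite eqxx big1 ?addr0 // => -[k1 k2] /= /andP[/eqP Ek nk].
case: ifP => [/eqP Ek1|_]; last by rewrite mul0r.
case/negP: nk; apply/eqP; congr pair; apply/val_inj => //=.
by rewrite -Ek1 [X in (X - _)%MM]Ek addmC addmK.
Qed.

(** Membership in the [d]-th power of the ideal generated by the variables. *)
Definition vanish d f := forall m, (mdeg m < d)%N -> fcoef f m = 0.

Lemma vanish0 d : vanish d 0.
Proof. by move=> m _ /=; rewrite if_same. Qed.

Lemma vanishW d e f : (e <= d)%N -> vanish d f -> vanish e f.
Proof. by move=> led fd m lt_me; apply: fd; apply: leq_trans led. Qed.

Lemma vanishD d f g : vanish d f -> vanish d g -> vanish d (f + g).
Proof. by move=> fd gd m ltm /=; rewrite fd ?gd ?addr0. Qed.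

Lemma vanishN d f : vanish d f -> vanish d (- f).
Proof. by move=> fd m ltm /=; rewrite fd ?oppr0. Qed.

Lemma vanishB d f g : vanish d f -> vanish d g -> vanish d (f - g).
Proof. by move=> fd gd; apply: vanishD (vanishN _). Qed.

Lemma vanishM d e f g : vanish d f -> vanish e g -> vanish (d + e) (f * g).
Proof.
move=> fd ge m ltm; rewrite fcoefM big1 // => -[k1 k2] /= /eqP Em.
have [lt1|le1] := ltnP (mdeg k1) d; first by rewrite fd ?mul0r.
have [lt2|le2] := ltnP (mdeg k2) e; first by rewrite ge ?mulr0.
by case/negP: (leq_gtF (leq_add le1 le2)); rewrite -mdegD -Em.
Qed.

Lemma vanishMl d f g : vanish d g -> vanish d (f * g).
Proof.
by move=> gd; rewrite -[d]add0n; apply: vanishM.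
Qed.

Lemma vanishX d f k : vanish d f -> vanish (k * d) (f ^+ k).
Proof.
by move=> fd; elim: k => [|k IHk] //; rewrite exprS mulSn; apply: vanishM.
Qed.

Lemma vanish_sum d (I : finType) (F : I -> fps K n) :
  (forall i, vanish d (F i)) -> vanish d (\sum_i F i).
Proof.
by move=> Fd; elim/big_ind: _ => //; [apply: vanish0 | apply: vanishD].
Qed.

Lemma vanish_eq0 f : (forall d, vanish d f) -> f = 0.
Proof.
by move=> f0; apply: fpsP => m; rewrite (f0 (mdeg m).+1) //= if_same.
Qed.

Lemma vanish_limit (s : nat -> fps K n) :
  (forall k, vanish k (s k.+1 - s k)) ->
  exists g, forall k, vanish k (g - s k).
Proof.
(* Coefficients of degree d are stationary from [s d.+1] on, hence the index [(mdeg m).+1]. *)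
move=> sP; exists (Fps (fun m => fcoef (s (mdeg m).+1) m)) => k m lt_mk /=.
apply/eqP; rewrite subr_eq0; apply/eqP.
elim: k lt_mk => // k IHk; rewrite ltnS leq_eqVlt => /predU1P[->//|lt_mk].
rewrite IHk //; apply/esym/eqP; rewrite -subr_eq0 -fcoefB.
by rewrite (sP k).
Qed.

(** The inverse is the geometric series in [f], the limit of its partial sums. *)
Lemma vanish1_unit f : vanish 1 f -> exists g, (1 - f) * g = 1.
Proof.
move=> f1; have fX k : vanish k (f ^+ k).
  by rewrite -{1}[k]muln1; apply: vanishX.
have [|g gP] := @vanish_limit (fun k => \sum_(i < k) f ^+ i).
  by move=> k; rewrite big_ord_recr addrC addKr.
exists g; apply/eqP; rewrite -subr_eq0; apply/eqP/vanish_eq0 => k.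
have ->: (1 - f) * g - 1 = (1 - f) * (g - \sum_(i < k) f ^+ i) - f ^+ k.
  have ->: f ^+ k = (f - 1) * (\sum_(i < k) f ^+ i) + 1.
    by rewrite -subrX1 subrK.
  by ring.
by apply: vanishB => //; apply: vanishMl.
Qed.

(** Each monomial of positive degree is charged to one variable dividing it, so that no coefficient
    is counted twice. This drives the induction giving continuity of homomorphisms. *)
Lemma vanishSE d f : vanish d.+1 f -> exists2 g : 'I_n -> fps K n,
  forall i, vanish d (g i) & f = \sum_i fps_monomial 1 U_(i)%MM * g i.
Proof.
pose first m := [pick i : 'I_n | m i != 0%N].
move=> fd; exists (fun i => Fps (fun m =>
  if first (m + U_(i))%MM == Some i then fcoef f (m + U_(i))%MM else 0)).
  by move=> i m ltm /=; rewrite fd ?if_same // mdegD mdeg1 addn1.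
apply: fpsP => m; rewrite fcoef_sum.
have Uimp i : first m = Some i -> (U_(i) <= m)%MM.
  by rewrite /first; case: pickP => // j mj [<-]; rewrite lep1mP.
under eq_bigr => i _.
  rewrite fcoef_monomialM /= mul1r.
  rewrite (_ : (if _ then _ else _) =
    if first m == Some i then fcoef f m else 0).
    over.
  case: ifP => [leU|nleU]; first by rewrite submK.
  by case: eqP => // /Uimp; rewrite nleU.
case Ef: (first m) => [i|].
  rewrite (bigD1 i) //= eqxx big1 ?addr0 // => j /negPf nji.
  by case: eqP => // -[Eij]; rewrite Eij eqxx in nji.
rewrite big1 //; apply: fd.
suff ->: m = 0%MM by rewrite mdeg0.
apply/mnmP => i; rewrite mnm0E; move: Ef; rewrite /first.
by case: pickP => // /(_ i) /negbFE/eqP.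
Qed.

End PowerSeries.

(** * Orders of vanishing in K[[t]] *)

Section OneVariable.
Variable K : fieldType.
Implicit Types (f g : fps1 K) (d e k : nat).

Lemma mdeg_multinom1 k : mdeg [multinom k | i < 1] = k.
Proof. by rewrite mdegE big_ord1 mnmE. Qed.

Lemma multinom1E (m : 'X_{1..1}) : m = [multinom mdeg m | i < 1].
Proof. by apply/mnmP => i; rewrite mnmE mdegE big_ord1 (ord1 i). Qed.

Lemma vanishS d f : vanish d f -> tcoef f d = 0 -> vanish d.+1 f.
Proof.
move=> fd fd0 m; rewrite ltnS leq_eqVlt => /predU1P[Em|]; last exact: fd.
by rewrite (multinom1E m) Em.
Qed.

Lemma tcoef_vanish d f k : vanish d f -> (k < d)%N -> tcoef f k = 0.
Proof. by move=> fd ltk; apply: fd; rewrite mdeg_multinom1. Qed.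

Lemma tcoefC (c : K) f k : tcoef (fpsC 1 c * f) k = c * tcoef f k.
Proof.
(* A constant unfolds to the monomial of exponent 0. *)
rewrite /tcoef (fcoef_monomialM c 0%MM).
rewrite ifT; last by apply/mnm_lepP => i; rewrite mnm0E.
congr (_ * fcoef _ _).
by apply/mnmP => i; rewrite mnmBE mnm0E subn0.
Qed.

(** A nonzero term needs exponents at least [d] and [e]; as they add up to [d + e], only one pair
    remains. *)
Lemma tcoefM_lead d e f g : vanish d f -> vanish e g ->
  tcoef (f * g) (d + e) = tcoef f d * tcoef g e.
Proof.
move=> fd ge; rewrite /tcoef fcoefM; set m := [multinom (d + e)%N | _ < _].
have dm : mdeg m = (d + e)%N by apply: mdeg_multinom1.
have ltd : (mdeg [multinom d | _ < 1] < (mdeg m).+1)%N.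
  by rewrite dm mdeg_multinom1 ltnS leq_addr.
have lte : (mdeg [multinom e | _ < 1] < (mdeg m).+1)%N.
  by rewrite dm mdeg_multinom1 ltnS leq_addl.
rewrite (bigD1 (BMultinom ltd, BMultinom lte)) /=; last first.
  by apply/eqP/mnmP => i; rewrite mnmDE !mnmE.
rewrite big1 ?addr0 // => -[k1 k2] /= /andP[/eqP Em nk].
have [lt1|le1] := ltnP (mdeg k1) d; first by rewrite fd ?mul0r.
have [lt2|le2] := ltnP (mdeg k2) e; first by rewrite ge ?mulr0.
have Ede : (d + e = mdeg k1 + mdeg k2)%N by rewrite -dm -mdegD -Em.
have Ed : d = mdeg k1 by apply/eqP; rewrite eqn_leq le1; lia.
have Ee : e = mdeg k2 by apply/eqP; rewrite eqn_leq le2; lia.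
case/negP: nk; apply/eqP; congr pair; apply/val_inj => /=.
  by rewrite [LHS]multinom1E -Ed.
by rewrite [LHS]multinom1E -Ee.
Qed.

Lemma tordP f k : tord f = Some k <-> vanish k f /\ tcoef f k != 0.
Proof.
have min_unique i : vanish k f -> tcoef f k != 0 -> vanish i f ->
    tcoef f i != 0 -> i = k.
  move=> fk nk fi ni; apply/eqP; rewrite eqn_leq.
  apply/andP; split; rewrite leqNgt.
    by apply/negP => /(tcoef_vanish fi) k0; move: nk; rewrite k0 eqxx.
  by apply/negP => /(tcoef_vanish fk) i0; move: ni; rewrite i0 eqxx.
rewrite /tord; case: pselect => [ex|nex]; last first.
  by split=> // -[_ nk]; case: nex; exists k.
case: ex_minnP => i ni le_i; have fi : vanish i f.
  move=> m lt_mi; rewrite (multinom1E m); apply/eqP/negPn/negP => /le_i.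
  by rewrite leqNgt lt_mi.
by split=> [[<-]//|[fk nk]]; rewrite (min_unique i).
Qed.

Lemma tord_None f : tord f = None <-> f = 0.
Proof.
rewrite /tord; case: pselect => [[k nk]|nex]; split=> //.
  by move=> f0; case/eqP: nk; rewrite f0 /tcoef /= if_same.
move=> _; apply: fpsP => m; rewrite (multinom1E m) /= if_same.
by apply/eqP/negPn/negP => nm; case: nex; exists (mdeg m).
Qed.

Lemma tord_vanish f k : tord f = Some k -> vanish k f.
Proof. by case/tordP. Qed.

Lemma tord_neq0 f : f <> 0 -> exists k, tord f = Some k.
Proof.
by move=> f0; case Ef: (tord f) => [k|]; [exists k | case: f0; apply/tord_None].
Qed.

Lemma tordM f g d e : tord f = Some d -> tord g = Some e ->
  tord (f * g) = Some (d + e)%N.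
Proof.
move=> /tordP[fd nf] /tordP[ge ng]; apply/tordP; split; first exact: vanishM.
by rewrite tcoefM_lead // mulf_neq0.
Qed.

Lemma fps1_mul_eq0 f g : f * g = 0 -> f = 0 \/ g = 0.
Proof.
move=> fg0; case: (pselect (f = 0)) => [|/tord_neq0[d fd]]; first by left.
case: (pselect (g = 0)) => [|/tord_neq0[e ge]]; first by right.
by have := tordM fd ge; rewrite fg0 (_ : tord 0 = None) //; apply/tord_None.
Qed.

Definition tpow k : fps1 K := fps_monomial 1 [multinom k | i < 1].

Lemma tord_tpow k : tord (tpow k) = Some k.
Proof.
apply/tordP; split; last by rewrite /tcoef /= eqxx oner_neq0.
by move=> m ltmk /=; case: eqP => // Em; rewrite Em mdeg_multinom1 ltnn in ltmk.
Qed.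

Lemma tcoef1_0 : tcoef (1 : fps1 K) 0 = 1.
Proof.
by rewrite /tcoef /=; case: eqP.
Qed.

Lemma tord1 : tord (1 : fps1 K) = Some 0%N.
Proof.
by apply/tordP; split=> //; rewrite tcoef1_0 oner_neq0.
Qed.

Lemma tordX f d k : tord f = Some d -> tord (f ^+ k) = Some (k * d)%N.
Proof.
move=> fd; elim: k => [|k IHk]; first by rewrite expr0 mul0n tord1.
by rewrite exprS mulSn; apply: tordM.
Qed.

End OneVariable.

(** * K-algebra homomorphisms K[[x]] -> K[[t]]: continuity and image *)

Section AlgebraMorphism.
Variables (K : fieldType) (n : nat) (phi : {rmorphism fps K n -> fps1 K}).
Hypothesis phiC : forall c, phi (fpsC n c) = fpsC 1 c.

(** If the constant term c of [phi f] were nonzero, the unit 1 - f/c would be sent to a series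
    without constant term. *)
Lemma morph_vanish1 f : vanish 1 f -> vanish 1 (phi f).
Proof.
move=> f1; apply: vanishS => //; set c := tcoef (phi f) 0.
apply/eqP; apply: contraT => nc.
have [g /(congr1 phi)] : exists g, (1 - fpsC n c^-1 * f) * g = 1.
  by apply: vanish1_unit; apply: vanishMl.
rewrite rmorphM rmorphB rmorph1 rmorphM /= phiC.
move=> /(congr1 (fun h => tcoef h 0)).
rewrite (@tcoefM_lead _ 0 0) // tcoef1_0.
rewrite [tcoef (_ - _) _](_ : _ = tcoef (1 : fps1 K) 0 -
  tcoef (fpsC 1 c^-1 * phi f) 0) // tcoef1_0 tcoefC mulVf // subrr mul0r.
by move/eqP; rewrite eq_sym oner_eq0.
Qed.

Lemma morph_vanish d f : vanish d f -> vanish d (phi f).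
Proof.
elim: d f => // d IHd f /vanishSE[g gd ->]; rewrite rmorph_sum.
apply: vanish_sum => i; rewrite rmorphM.
apply: (@vanishM _ _ 1 d); last exact: IHd.
apply: morph_vanish1 => m /=; rewrite ltnS leqn0 mdeg_eq0 => /eqP->.
by case: eqP => // /esym/eqP; rewrite -mdeg_eq0 mdeg1.
Qed.

(** Removing from [f] its constant term leaves an element that [phi] sends to order at least 1, so
    [f] and [phi f] have the same constant term. *)
Lemma morph_vanish1_inv f : vanish 1 (phi f) -> vanish 1 f.
Proof.
move=> phif1; set c := fcoef f 0%MM.
have f1 : vanish 1 (f - fpsC n c).
  by move=> m; rewrite ltnS leqn0 mdeg_eq0 => /eqP-> /=; rewrite eqxx subrr.
have := vanishB phif1 (morph_vanish1 f1).
rewrite rmorphB /= phiC opprB addrCA subrr addr0 => /(_ 0%MM).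
rewrite mdeg0 /= eqxx => /(_ isT) c0.
by move=> m; rewrite ltnS leqn0 mdeg_eq0 => /eqP->.
Qed.

Variables a b a0 : fps K n.
Hypotheses (phi_ab : phi a = phi b * tpow K 1) (phib : phi b <> 0).
Hypothesis phia0 : phi a0 <> 0.

(* With [q] the order of [phi b], the elements [a0 b^(q+1-i) a^(i+j)],
   [0 <= i <= q], have images of order [D + (q+1) j + i] and lie in the [j]-th
   power of the maximal ideal. *)
Lemma approximation_step : exists D q, forall j h, vanish (D + q.+1 * j) h ->
  exists2 g, vanish j g & vanish (D + q.+1 * j.+1) (h - phi (a0 * g)).
Proof.
have [q ordb] := tord_neq0 phib; have [e orda0] := tord_neq0 phia0.
have orda : tord (phi a) = Some q.+1.
  by rewrite phi_ab -(addn1 q); apply: tordM ordb (tord_tpow _ _).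
have a1 : vanish 1 a.
  by apply: morph_vanish1_inv; apply: vanishW (tord_vanish orda).
(* The value of [D] comes from e + (q+1-i)q + (i+j)(q+1) = (e + (q+1)q) + (q+1)j + i. *)
pose D := (e + q.+1 * q)%N; exists D, q => j h hj.
(* Each correction gains one order; after q+1 of them [j] can increase by one. *)
suff H i : (i <= q.+1)%N ->
    exists2 g, vanish j g & vanish (D + q.+1 * j + i) (h - phi (a0 * g)).
  by rewrite mulnS [(q.+1 + _)%N]addnC addnA; apply: H.
elim: i => [_|i IHi lt_iq].
  by exists 0; [apply: vanish0 | rewrite mulr0 rmorph0 subr0 addn0].
have [g gj hg] := IHi (ltnW lt_iq); set k := (D + _ + i)%N in hg *.
pose w := b ^+ (q.+1 - i) * a ^+ (i + j).
have wj : vanish j w.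
  apply: vanishMl; apply: (@vanishW _ _ ((i + j) * 1)); last exact: vanishX.
  by rewrite muln1 leq_addl.
have ordw : tord (phi (a0 * w)) = Some k.
  rewrite !rmorphM !rmorphXn /=.
  rewrite (tordM orda0 (tordM (tordX _ ordb) (tordX _ orda))) /k /D.
  congr Some; have [r Er] : exists r, (q.+1 = r + i)%N.
    by exists (q.+1 - i)%N; rewrite subnK // ltnW.
  by rewrite Er addnK; move: Er; nia.
have [wk nw] : vanish k (phi (a0 * w)) /\ tcoef (phi (a0 * w)) k != 0.
  exact/tordP.
(* This multiple of [w] cancels the coefficient of order [k] in the current error. *)
pose c := tcoef (h - phi (a0 * g)) k / tcoef (phi (a0 * w)) k.
exists (g + fpsC n c * w); first by apply: vanishD => //; apply: vanishMl.
have ->: h - phi (a0 * (g + fpsC n c * w)) =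
    h - phi (a0 * g) - fpsC 1 c * phi (a0 * w).
  rewrite mulrDr mulrCA rmorphD (rmorphM phi (fpsC n c)) /= phiC.
  by rewrite opprD addrA.
rewrite addnS; apply: vanishS; first by apply: vanishB => //; apply: vanishMl.
rewrite [tcoef _ _](_ : _ = tcoef (h - phi (a0 * g)) k -
  tcoef (fpsC 1 c * phi (a0 * w)) k) //.
by rewrite tcoefC divfK // subrr.
Qed.

Lemma morph_image_conductor :
  exists N, forall h, vanish N h -> exists g, phi (a0 * g) = h.
Proof.
have [D [q step]] := approximation_step; exists D => h hD.
(* A state is a stage with its current error; [next] gives the correction, with default 0 when the
   error is not small enough for the stage. *)
have /choice[next nextP] : forall x : nat * fps1 K, exists g : fps K n,
    vanish (D + q.+1 * x.1) x.2 ->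
    vanish x.1 g /\ vanish (D + q.+1 * x.1.+1) (x.2 - phi (a0 * g)).
  move=> [j h'] /=; have [/step[g]|] := pselect (vanish (D + q.+1 * j) h').
    by exists g.
  by exists 0.
pose fix s j := if j is j'.+1 then s j' + next (j', h - phi (a0 * s j')) else 0.
have sP j : vanish (D + q.+1 * j) (h - phi (a0 * s j)).
  elim: j => [|j IHj] /=; first by rewrite muln0 addn0 mulr0 rmorph0 subr0.
  by have [_] := nextP (j, _) IHj; rewrite mulrDr rmorphD opprD addrA.
have [j|g gP] := @vanish_limit _ _ s.
  by rewrite /= [s j + _]addrC addrK; case: (nextP (j, _) (sP j)).
exists g; apply/eqP; rewrite eq_sym -subr_eq0; apply/eqP/vanish_eq0 => j.
(* The first difference is small by construction of [s], the last term by continuity of [phi]. *)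
have ->: h - phi (a0 * g) = h - phi (a0 * s j) - phi (a0 * (g - s j)).
  by rewrite mulrBr rmorphB /=; ring.
apply: vanishB; first by apply: vanishW (sP j); nia.
by apply: morph_vanish; apply: vanishMl.
Qed.

End AlgebraMorphism.

(** * The curve: branch primes, zero divisors, conductor and values *)

Lemma minimal_primes_incomparable (R : nzRingType) (Q : {pred R})
    (P P' : prime_idealr R) :
  minimal_prime_over Q P -> minimal_prime_over Q P' -> ~ (P =i P') ->
  exists2 f, f \in P & f \notin P'.
Proof.
move=> [QP _] [_ minP'] nPP'; apply: contrapT => nex; apply: nPP'.
have PP' : {subset P <= P'}.
  by move=> f fP; apply/negPn/negP => nf; apply: nex; exists f.
(* Once [P] lies in [P'], minimality of [P'] gives the reverse inclusion. *)
by move=> f; apply/idP/idP => [/PP'|/(minP' _ QP PP')].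
Qed.

Section Curve.
Variables (K : fieldType) (n : nat) (C : two_branch_curve K n).
Local Notation A := (curve_ring C).
Local Notation piA := (\pi_{ideal_quot (curve_ideal C)}%qT).
Implicit Types (r s : A) (f : fps K n).

Let lift r : exists f, r = piA f.
Proof. by exists (repr r); rewrite reprK. Qed.

(** The two coordinates have kernels P_1 and P_2, and Q is their intersection. *)
Lemma param_eq0 r : (param C r).1 = 0 -> (param C r).2 = 0 -> r = 0.
Proof.
have [f ->] := lift r => /param_ker1 f1 /param_ker2 f2.
apply/eqP; rewrite -[0](rmorph0 piA) -Quotient.idealrBE subr0.
by rewrite curve_idealE f1.
Qed.

Lemma curve_mul_eq0 f g : f \in branch1 C -> g \in branch2 C ->
  piA f * piA g = 0 :> A.
Proof.
move=> f1 g2; apply: param_eq0; rewrite rmorphM /=.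
  by rewrite ((param_ker1 C f).2 f1) mul0r.
by rewrite ((param_ker2 C g).2 g2) mulr0.
Qed.

(** An element vanishing on one branch is killed by the class of a series taken from the other prime
    only; conversely K[[t]] is a domain. *)
Lemma zero_divisorPn r :
  ~ zero_divisor r <-> (param C r).1 <> 0 /\ (param C r).2 <> 0.
Proof.
split=> [nzd|[r1 r2] [s /eqP s0 rs0]]; last first.
  apply: s0; have := congr1 (param C) rs0; rewrite rmorphM rmorph0 => E.
  apply: param_eq0.
    by have [/r1|] := fps1_mul_eq0 (congr1 fst E).
  by have [/r2|] := fps1_mul_eq0 (congr1 snd E).
have min1 := (branch_minimal C _).2 (or_introl (fun=> erefl)).
have min2 := (branch_minimal C _).2 (or_intror (fun=> erefl)).
have [g1 g11 ng12] :=
  minimal_primes_incomparable min1 min2 (branch_neq (t := C)).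
have [g2 g22 ng21] : exists2 f, f \in branch2 C & f \notin branch1 C.
  apply: minimal_primes_incomparable min2 min1 _ => E.
  by apply: (branch_neq (t := C)) => f.
have [f rf] := lift r; rewrite rf in nzd *.
split=> [/param_ker1 f1|/param_ker2 f2]; apply: nzd.
  exists (piA g2); last exact: curve_mul_eq0.
  apply: contraNneq ng21 => g0; apply/param_ker1.
  by rewrite [piA g2]g0 rmorph0.
exists (piA g1); last by rewrite mulrC; apply: curve_mul_eq0.
apply: contraNneq ng12 => g0; apply/param_ker2.
by rewrite [piA g1]g0 rmorph0.
Qed.

(** The integral closure sits inside the total ring of fractions of R. *)
Lemma param_fraction (z : fps1 K * fps1 K) :
  exists a b : A, ~ zero_divisor b /\ z * param C b = param C a.
Proof.
have [T [i [j [[_ _ frac] ji injj _]]]] := param_integral_closure C.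
have [a [b [nzb zb]]] := frac (j z); exists a, b; split=> //.
by apply: injj; rewrite rmorphM !ji.
Qed.

Definition coord1 : {rmorphism fps K n -> fps1 K} := fst \o (param C \o piA).
Definition coord2 : {rmorphism fps K n -> fps1 K} := snd \o (param C \o piA).

Lemma conductor1 :
  exists N, forall h, vanish N h -> exists r, param C r = (h, 0).
Proof.
have [a [b [/zero_divisorPn[b1 b2] ab]]] := param_fraction (tpow K 1, tpow K 1).
(* As [b0] is not a zero divisor, [a0] is nonzero on the first branch and zero on the second, and so
   are the multiples of [a0] that hit (h, 0), up to h = 0. *)
have [a0 [b0 [/zero_divisorPn[b01 b02] ab0]]] := param_fraction (1, 0).
have [[fa ea] [fb eb]] := (lift a, lift b); have [fa0 ea0] := lift a0.
have [||||N NP] := @morph_image_conductor K n coord1 _ fa fb fa0.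
- by move=> c; rewrite /= param_const.
- by rewrite mulrC /= -ea -eb -ab.
- by rewrite /= -eb.
- by rewrite /= -ea0 -ab0 /= mul1r.
exists N => h /NP[g gh]; exists (piA (fa0 * g)).
rewrite [LHS]surjective_pairing; congr pair => //.
by rewrite rmorphM rmorphM /= -ea0 -ab0 /= !mul0r.
Qed.

Lemma conductor2 :
  exists N, forall h, vanish N h -> exists r, param C r = (0, h).
Proof.
have [a [b [/zero_divisorPn[b1 b2] ab]]] := param_fraction (tpow K 1, tpow K 1).
have [a0 [b0 [/zero_divisorPn[b01 b02] ab0]]] := param_fraction (0, 1).
have [[fa ea] [fb eb]] := (lift a, lift b); have [fa0 ea0] := lift a0.
have [||||N NP] := @morph_image_conductor K n coord2 _ fa fb fa0.
- by move=> c; rewrite /= param_const.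
- by rewrite mulrC /= -ea -eb -ab.
- by rewrite /= -eb.
- by rewrite /= -ea0 -ab0 /= mul1r.
exists N => h /NP[g gh]; exists (piA (fa0 * g)).
rewrite [LHS]surjective_pairing; congr pair => //.
by rewrite rmorphM rmorphM /= -ea0 -ab0 /= !mul0r.
Qed.

(** Having two finite orders already excludes zero divisors, so S is the finite part of the semiring
    of values. *)
Lemma value_semigroupP a b : value_semigroup C (a, b) <->
  exists r, value r = (Some a, Some b).
Proof.
split=> [[r _ rab]|[r rab]]; exists r => //.
have [r1 r2] : tord (param C r).1 = Some a /\ tord (param C r).2 = Some b.
  by case: rab.
by apply/zero_divisorPn; split=> /tord_None; rewrite ?r1 ?r2.
Qed.

Lemma value_infty1 a : (exists r, value r = (Some a, None)) <->
  exists y0, forall y, (y0 <= y)%N -> value_semigroup C (a, y).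
Proof.
have [N NP] := conductor2; split=> [[r [r1 /tord_None r2]]|[y0 y0P]].
  exists N => y leNy; apply/value_semigroupP.
  (* Adding (0, t^y) to an element of value (a, oo) gives value (a, y). *)
  have [s sy] := NP (tpow K y) (vanishW leNy (tord_vanish (tord_tpow K y))).
  exists (r + s); rewrite /value rmorphD sy /=.
  by rewrite r2 add0r addr0 tord_tpow r1.
(* Beyond [y0] the pair is a value of some [r]; beyond [N] the element (0, r_2) comes from R and can
   be subtracted from [r]. *)
have /value_semigroupP[r [r1 r2]] := y0P (maxn y0 N) (leq_maxl _ _).
have [s sr] := NP _ (vanishW (leq_maxr _ _) (tord_vanish r2)).
exists (r - s); rewrite /value rmorphB sr /= subr0 subrr r1.
by congr pair; apply/tord_None.
Qed.

Lemma value_infty2 b : (exists r, value r = (None, Some b)) <->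
  exists x0, forall x, (x0 <= x)%N -> value_semigroup C (x, b).
Proof.
have [N NP] := conductor1; split=> [[r [/tord_None r1 r2]]|[x0 x0P]].
  exists N => x leNx; apply/value_semigroupP.
  have [s sx] := NP (tpow K x) (vanishW leNx (tord_vanish (tord_tpow K x))).
  exists (r + s); rewrite /value rmorphD sx /=.
  by rewrite r1 add0r addr0 tord_tpow r2.
have /value_semigroupP[r [r1 r2]] := x0P (maxn x0 N) (leq_maxl _ _).
have [s sr] := NP _ (vanishW (leq_maxr _ _) (tord_vanish r1)).
exists (r - s); rewrite /value rmorphB sr /= subr0 subrr r2.
by congr pair; apply/tord_None.
Qed.

End Curve.

Theorem proposition3 (K : fieldType) (n : nat) (C : two_branch_curve K n) :
  Gamma (value_semigroup C) = value_semiring C.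
Proof.
apply/seteqP; split=> v.
  move=> [[[a b] /value_semigroupP[r rv] <-]|[[|]|->]].
  - by exists r.
  - by move=> [a /value_infty1[r rv] <-]; exists r.
  - by move=> [b /value_infty2[r rv] <-]; exists r.
  (* The point (oo, oo) is the value of 0. *)
  - by exists 0; rewrite // /value rmorph0; congr pair; apply/tord_None.
move=> [r _ <-]; case rv: (value r) => [[a|] [b|]].
- by left; exists (a, b) => //; apply/value_semigroupP; exists r.
- by right; left; left; exists a => //; apply/value_infty1; exists r.
- by right; left; right; exists b => //; apply/value_infty2; exists r.
- by right; right.
Qed.
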